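(* For all $n \ge 1$ and all $k \ge 2$ there exists a bijection between $S_n(123, 132, (k-1)(k-2)\ldots 1\,k)$ and the set of tilings of a $1 \times n$ rectangle with tiles of sizes $1\times 1, 1\times 2, \ldots, 1\times (k-1)$.
   Context: Permutations of $[n]$ are written in one-line notation, and $S_n$ denotes the set of them. A permutation $\pi\in S_n$ contains $\sigma\in S_m$ if there are indices $i_1<\dots<i_m$ such that for all $a,b$, $\pi(i_a)<\pi(i_b)$ iff $\sigma(a)<\sigma(b)$; otherwise $\pi$ avoids $\sigma$. For a set $R$ of permutations, $S_n(R)$ is the set of $\pi\in S_n$ avoiding every element of $R$. The permutation $(k-1)(k-2)\ldots 1\,k\in S_k$ lists $k-1,\dots,1$ in decreasing order followed by $k$. *)

(* Defs.v *)
From mathcomp Require Import all_boot all_fingroup zify.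

Set Implicit Arguments.
Unset Strict Implicit.
Unset Printing Implicit Defensive.

(* Permutations of [n] are elements of 'S_n = {perm 'I_n}: positions and values
   are numbered from 0 instead of 1. *)
Definition one_line n (s : 'S_n) : seq nat := [seq (s i).+1 | i <- enum 'I_n].

Definition contains n m (s : 'S_n) (t : 'S_m) : bool :=
  [exists f : {ffun 'I_m -> 'I_n},
    [forall a : 'I_m, forall b : 'I_m, (a < b) ==> (f a < f b)] &&
    [forall a : 'I_m, forall b : 'I_m, (s (f a) < s (f b)) == (t a < t b)]].

Definition pattern : Type := {m : nat & 'S_m}.

Definition Pattern m (t : 'S_m) : pattern := existT _ m t.

Definition avoiders n (R : seq pattern) : {set 'S_n} :=
  [set s : 'S_n | all (fun p : pattern => ~~ contains s (projT2 p)) R].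

Definition p123 : 'S_3 := 1%g.

Definition p132 : 'S_3 := tperm (inord 1) (inord 2).

Fact dec_max_subproof k (i : 'I_k) : (if i.+1 < k then k - 2 - i else i) < k.
Proof. by have := ltn_ord i; case: ifP; lia. Qed.

Definition dec_max_fun k (i : 'I_k) : 'I_k := Ordinal (dec_max_subproof i).

Fact dec_max_fun_inj k : injective (@dec_max_fun k).
Proof.
move=> i j /(congr1 val) /= eq_ij; apply: val_inj => /=.
have := ltn_ord i; have := ltn_ord j; move: eq_ij.
by case: ifP; case: ifP; lia.
Qed.

(* The permutation (k-1)(k-2)...1 k. *)
Definition dec_max k : 'S_k := perm (@dec_max_fun_inj k).

(* A tile of size 1 x l is a block of l consecutive cells among the n cells of
   the rectangle; a tiling is the set of its tiles. *)
Definition is_tile n l (B : {set 'I_n}) : bool :=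
  [exists i : 'I_n, (i + l <= n) && (B == [set x : 'I_n | i <= x < i + l])].

(* Tilings of a 1 x n rectangle by tiles of sizes 1 x 1, ..., 1 x d. *)
Definition tilings n d : {set {set {set 'I_n}}} :=
  [set T : {set {set 'I_n}} | partition T [set: 'I_n] &&
     [forall B in T, exists l : 'I_d, is_tile l.+1 B]].

Fact one_line_p123 : one_line p123 = [:: 1; 2; 3].
Proof. by rewrite /one_line !enum_ordSl enum_ord0 /= !perm1. Qed.

Fact one_line_p132 : one_line p132 = [:: 1; 3; 2].
Proof.
rewrite /one_line !enum_ordSl enum_ord0 /= !permE /=.
by rewrite -!val_eqE /= !inordK.
Qed.

Fact one_line_dec_max k :
  0 < k -> one_line (dec_max k) = rcons (rev (iota 1 k.-1)) k.
Proof.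
case: k => // k _; rewrite /one_line; apply: (@eq_from_nth _ 0).
  by rewrite size_map size_enum_ord size_rcons size_rev size_iota.
move=> i; rewrite size_map size_enum_ord => lt_ik.
rewrite (nth_map (Ordinal lt_ik)) ?size_enum_ord // permE /= nth_enum_ord //.
rewrite nth_rcons size_rev size_iota /= ltnS.
case: (ltngtP i k) => [lt_i | gt_i | ->] //; last by lia.
by rewrite nth_rev ?size_iota // nth_iota; lia.
Qed.

(* Main.v *)
Require Import Defs.
From mathcomp Require Import all_boot all_fingroup.
From mathcomp Require Import zify.

Set Implicit Arguments.
Unset Strict Implicit.
Unset Printing Implicit Defensive.

(** Let c_i be the number of later entries of a permutation s that exceed its
    i-th entry. Like the Lehmer code, c determines s, and every c with
    c_i < n - i (0-based) occurs. A permutation avoids 123 and 132 exactly when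
    c_i <= 1 for all i, so it is determined by the set E of its right-to-left
    maxima, where c_i = 0. The entries strictly between two consecutive
    right-to-left maxima decrease and are smaller than the second of them;
    hence s avoids (k-1)...1 k exactly when E meets every window of k-1
    consecutive cells. Cutting the
    rectangle after the cells of E gives the tiling. *)

Lemma imset_sig_bij (aT rT : finType) (A : {set aT}) (B : {set rT}) (f : aT -> rT) :
    {in A &, injective f} -> f @: A = B ->
  exists g : {x | x \in A} -> {y | y \in B}, bijective g.
Proof.
move=> f_inj fA; have fAB x : x \in A -> f x \in B by rewrite -fA; apply: imset_f.
exists (fun x => exist _ (f (sval x)) (fAB _ (svalP x))).
apply: inj_card_bij => [x y [/f_inj eq_xy]|].
  exact: val_inj (eq_xy (svalP x) (svalP y)).
by rewrite !card_sig -(card_in_imset f_inj) fA.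
Qed.

Lemma card_ord_ltn n m : m <= n -> #|[set i : 'I_n | i < m]| = m.
Proof.
move=> le_mn; rewrite -sum1dep_card.
by rewrite -(big_ord_widen n (fun=> 1) le_mn) sum1_card card_ord.
Qed.

Lemma ltn_permN n (s : 'S_n) (i j : 'I_n) :
  i != j :> nat -> (s i < s j) = ~~ (s j < s i).
Proof. by rewrite val_eqE -(inj_eq (@perm_inj _ s)) -val_eqE /=; lia. Qed.

(** * Non-inversions *)

Definition noninversions n (s : 'S_n) (i : 'I_n) : {set 'I_n} :=
  [set j : 'I_n | (i < j) && (s i < s j)].

Lemma card_noninversions_bound n (s : 'S_n) i : #|noninversions s i| < n - i.
Proof.
have : noninversions s i \subset ~: [set j : 'I_n | j < i.+1].
  by apply/subsetP => j; rewrite !inE -leqNgt => /andP[].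
move/subset_leq_card; rewrite [leqRHS]cardsCs setCK card_ord card_ord_ltn //.
by have := ltn_ord i; lia.
Qed.

Lemma imset_noninversions n (s : 'S_n) i :
  s @: noninversions s i = [set v : 'I_n | s i < v] :\: s @: [set j : 'I_n | j < i].
Proof.
apply/setP => v; rewrite -(permKV s v) !inE !mem_imset ?inE; try exact: perm_inj.
by case: ltngtP => //= /val_inj ->; rewrite ltnn.
Qed.

Lemma card_noninversions_anti n (s t : 'S_n) (i : 'I_n) :
    (forall j : 'I_n, j < i -> s j = t j) -> s i < t i ->
  #|noninversions t i| < #|noninversions s i|.
Proof.
move=> eq_st st.
have eq_before : s @: [set j : 'I_n | j < i] = t @: [set j : 'I_n | j < i].
  by apply: eq_in_imset => j; rewrite inE => /eq_st.
rewrite -(card_imset _ (@perm_inj _ t)) -[ltnRHS](card_imset _ (@perm_inj _ s)).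
rewrite !imset_noninversions eq_before; apply/proper_card/properP; split.
  by apply/setSD/subsetP => v; rewrite !inE; apply: ltn_trans.
exists (t i); rewrite !inE ?ltnn ?andbF //.
by rewrite st andbT mem_imset ?inE ?ltnn //; apply: perm_inj.
Qed.

Lemma card_noninversions_inj n (s t : 'S_n) :
  (forall i, #|noninversions s i| = #|noninversions t i|) -> s = t.
Proof.
move=> eq_card; apply/permP => i.
have [m] := ubnP (i : nat); elim: m i => // m IHm i /ltnSE im.
have eq_st (j : 'I_n) : j < i -> s j = t j by move=> ji; apply: IHm; lia.
case: (ltngtP (s i) (t i)) => [st|ts|/val_inj//].
  by have := card_noninversions_anti eq_st st; rewrite eq_card ltnn.
have eq_ts (j : 'I_n) : j < i -> t j = s j by move/eq_st.
by have := card_noninversions_anti eq_ts ts; rewrite eq_card ltnn.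
Qed.

(* By counting: there are as many such [c] as permutations, namely n!. *)
Lemma card_noninversions_surj n (c : 'I_n -> nat) : (forall i, c i < n - i) ->
  exists s : 'S_n, forall i, #|noninversions s i| = c i.
Proof.
move=> c_lt; have lt_n m (i : 'I_n) : m < n - i -> m < n by lia.
pose code (s : 'S_n) : {ffun 'I_n -> 'I_n} :=
  [ffun i => Ordinal (lt_n _ _ (card_noninversions_bound s i))].
pose codes := [set f in family (fun i : 'I_n => [pred v : 'I_n | v < n - i])].
have card_codes : #|codes| = n`!.
  rewrite cardsE card_family foldrE big_map big_enum -ffactnn ffact_prod /=.
  by apply: eq_bigr => i _; rewrite -[RHS](@card_ord_ltn n) ?leq_subr // cardsE.
have code_inj : injective code.
  move=> s t /ffunP eq_st; apply: card_noninversions_inj => i.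
  by have := congr1 val (eq_st i); rewrite !ffunE.
have code_onto : [set code s | s in setT] = codes.
  apply/eqP; rewrite eqEcard card_imset // cardsT card_Sn card_codes leqnn andbT.
  apply/subsetP => _ /imsetP[s _ ->]; rewrite inE; apply/familyP => i.
  by rewrite ffunE inE card_noninversions_bound.
pose f : {ffun 'I_n -> 'I_n} := [ffun i => Ordinal (lt_n _ _ (c_lt i))].
have : f \in codes by rewrite inE; apply/familyP => i; rewrite ffunE inE c_lt.
rewrite -code_onto => /imsetP[s _ /ffunP f_code]; exists s => i.
by have := congr1 val (f_code i); rewrite !ffunE.
Qed.

(** * Pattern containment *)

Lemma containsP n m (s : 'S_n) (t : 'S_m) :
  reflect (exists2 f : 'I_m -> 'I_n, forall a b : 'I_m, a < b -> f a < f b &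
             forall a b, (s (f a) < s (f b)) = (t a < t b))
          (contains s t).
Proof.
apply: (iffP existsP) => [[f /andP[f_mono f_patt]]|[f f_mono f_patt]].
  exists f => a b; last by have /forallP/(_ b)/eqP := forallP f_patt a.
  by have /forallP/(_ b)/implyP := forallP f_mono a.
exists (finfun f); apply/andP.
split; apply/forallP => a; apply/forallP => b; rewrite !ffunE.
  exact/implyP/f_mono.
by rewrite f_patt.
Qed.

Lemma ord_increasing_gap n m (f : 'I_m -> 'I_n) (a b : 'I_m) :
    (forall x y : 'I_m, x < y -> f x < f y) -> a <= b ->
  f a + (b - a) <= f b.
Proof.
move=> f_mono ab; have [l] := ubnP (b - a); elim: l b ab => // l IHl b ab b_lt.
case: (ltngtP a b) ab => [ab|//|/val_inj -> _]; last by rewrite subnn addn0.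
have b_lt_m : b.-1 < m by have := ltn_ord b; lia.
have := IHl (Ordinal b_lt_m); have := f_mono (Ordinal b_lt_m) b.
by rewrite /=; lia.
Qed.

Lemma contains_intro n m (s : 'S_n) (t : 'S_m) (f : 'I_m -> 'I_n) :
    (forall a b : 'I_m, a < b -> f a < f b) ->
    (forall a b : 'I_m, a < b -> (s (f a) < s (f b)) = (t a < t b)) ->
  contains s t.
Proof.
move=> f_mono f_patt; apply/containsP; exists f => // a b.
case: (ltngtP a b) => [|ba|/val_inj ->]; [exact: f_patt | | by rewrite !ltnn].
have f_ba := f_mono _ _ ba.
by rewrite ltn_permN ?f_patt -?ltn_permN //; lia.
Qed.

Lemma contains_card_noninversions n m (s : 'S_n) (t : 'S_m) (a : 'I_m) :
  contains s t -> exists i, #|noninversions t a| <= #|noninversions s i|.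
Proof.
case/containsP => f f_mono f_patt; exists (f a).
have f_inj : injective f.
  move=> x y eq_xy; case: (ltngtP x y) => [||/val_inj //] /f_mono;
    by rewrite eq_xy ltnn.
rewrite -(card_imset _ f_inj); apply/subset_leq_card/subsetP => _ /imsetP[b + ->].
by rewrite !inE => /andP[ab t_ab]; rewrite f_mono // f_patt.
Qed.

Lemma card_noninversions_ord0 m (t : 'S_m.+1) :
  t ord0 = ord0 -> #|noninversions t ord0| = m.
Proof.
move=> t0; have -> : noninversions t ord0 = [set~ ord0].
  apply/setP => b; rewrite !inE t0 !lt0n andb_idr // => b_neq0.
  by rewrite -[0]/(val (@ord0 m)) val_eqE -{1}t0 (inj_eq perm_inj).
by rewrite cardsC1 card_ord.
Qed.

Lemma p132_ord0 : p132 ord0 = ord0.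
Proof. by rewrite /p132 tpermD // -val_eqE /= inordK. Qed.

Lemma val_p132 (i : 'I_3) : p132 i = nth 0 [:: 0; 2; 1] i :> nat.
Proof.
rewrite permE /= -!val_eqE /= !inordK //.
by case: i => [[|[|[|]]]] //= _; rewrite inordK.
Qed.

Lemma contains_p123_p132 n (s : 'S_n) (i j j' : 'I_n) :
    i < j -> j < j' -> s i < s j -> s i < s j' ->
  contains s (if s j < s j' then p123 else p132).
Proof.
move=> ij jj' sij sij'.
apply: (@contains_intro _ _ _ _ (fun a => nth i [:: i; j; j'] a)).
  by case=> [[|[|[|]]]] //= _ [[|[|[|]]]] //= _ _; lia.
case: ifP => sjj' a b; rewrite ?perm1 ?val_p132;
  by case: a b => [[|[|[|]]]] //= _ [[|[|[|]]]] //= _ _; lia.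
Qed.

Definition sparse_noninversions n (s : 'S_n) : bool :=
  [forall i, #|noninversions s i| <= 1].

Lemma avoids_p123_p132 n (s : 'S_n) :
  ~~ contains s p123 && ~~ contains s p132 = sparse_noninversions s.
Proof.
apply/andP/forallP => [[s123 s132] i|s_le1].
  apply/card_le1_eqP => j j' /= /[!inE] /andP[ij sij] /andP[ij' sij'].
  wlog jj' : j j' ij sij ij' sij' / j < j'.
    case: (ltngtP j j') => [jj'|jj'|/val_inj -> //] wl; first exact: wl.
    exact/esym/wl.
  have := contains_p123_p132 ij jj' sij sij'.
  by case: ifP; rewrite ?(negPf s123) ?(negPf s132).
by split; apply/negP => /(contains_card_noninversions ord0)[i];
  rewrite card_noninversions_ord0 ?perm1 ?p132_ord0 // leqNgt ltnS s_le1.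
Qed.

(** * Right-to-left maxima *)

Definition cofinal n (E : {set 'I_n}) : Prop :=
  forall i : 'I_n, exists2 e : 'I_n, e \in E & i <= e.

(* A window reaching past the right border is truncated, so the last cell
   belongs to [E]. *)
Definition meets_windows n d (E : {set 'I_n}) : bool :=
  [forall a : 'I_n, exists e in E, a <= e < a + d].

Lemma meets_windowsP n d (E : {set 'I_n}) :
  reflect (forall a : 'I_n, exists2 e : 'I_n, e \in E & a <= e < a + d)
          (meets_windows d E).
Proof. by apply: (iffP forallP) => E_meets a; apply/exists_inP. Qed.

Lemma meets_windows_cofinal n d (E : {set 'I_n}) : meets_windows d E -> cofinal E.
Proof.
by move/meets_windowsP => E_meets i; have [e Ee /andP[]] := E_meets i; exists e.
Qed.

Definition rl_maxima n (s : 'S_n) : {set 'I_n} :=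
  [set i | noninversions s i == set0].

Lemma rl_maxima_gt n (s : 'S_n) (i j : 'I_n) :
  i \in rl_maxima s -> i < j -> s j < s i.
Proof.
rewrite inE => /eqP i_max ij; rewrite ltn_permN ?gtn_eqF //.
by apply/negP => sij; have := in_set0 j; rewrite -i_max inE ij sij.
Qed.

Lemma rl_maximaN_lt n (s : 'S_n) (i : 'I_n) :
  i \notin rl_maxima s -> exists2 j : 'I_n, i < j & s i < s j.
Proof. by rewrite inE => /set0Pn[j]; rewrite inE => /andP[]; exists j. Qed.

Lemma rl_maxima_surj n (E : {set 'I_n}) :
  cofinal E -> exists2 s : 'S_n, sparse_noninversions s & rl_maxima s = E.
Proof.
move=> E_cofinal; have [i|s s_card] := @card_noninversions_surj n (fun i => i \notin E).
  have [e Ee ie] := E_cofinal i; have := ltn_ord e.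
  case: (boolP (i \in E)) => [_|Ei]; first by have := ltn_ord i; lia.
  have : i != e :> nat by apply: contraNneq Ei => /val_inj ->.
  by rewrite /=; lia.
exists s; first by apply/forallP => i; rewrite s_card; case: (i \notin E).
by apply/setP => i; rewrite inE -cards_eq0 s_card eqb0 negbK.
Qed.

Section SparseNoninversions.

Variables (n : nat) (s : 'S_n).
Hypothesis s_sparse : sparse_noninversions s.

Lemma card_sparse_noninversions i : #|noninversions s i| = (i \notin rl_maxima s).
Proof. by rewrite inE -cards_eq0; have := forallP s_sparse i; case: #|_| => [|[]]. Qed.

Lemma noninversion_unique (i j j' : 'I_n) :
  i < j -> i < j' -> s i < s j -> s i < s j' -> j = j'.
Proof.
move=> ij ij' sij sij'.
by apply: (card_le1_eqP (forallP s_sparse i)); rewrite inE ?ij ?ij'.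
Qed.

Lemma rl_maximaN_gt (i j : 'I_n) : i < j -> j \notin rl_maxima s -> s j < s i.
Proof.
move=> ij /rl_maximaN_lt[l jl sjl].
rewrite ltn_permN ?gtn_eqF //; apply/negP => sij.
have eq_jl := noninversion_unique ij (ltn_trans ij jl) sij (ltn_trans sij sjl).
by rewrite eq_jl ltnn in jl.
Qed.

Lemma rl_maxima_free_window d (a : 'I_n) : 0 < d ->
    (forall i : 'I_n, a <= i < a + d -> i \notin rl_maxima s) ->
  exists2 j : 'I_n, a + d <= j & forall i : 'I_n, a <= i < a + d -> s i < s j.
Proof.
move=> d_gt0 no_max.
have [|j aj saj] := @rl_maximaN_lt _ s a; first by apply: no_max; lia.
exists j => [|i /andP[ai ia]].
  rewrite leqNgt; apply/negP => ja.
  have := rl_maximaN_gt aj; rewrite no_max => [/(_ isT)|]; lia.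
case: (ltngtP a i) ai => [ai|//|/val_inj <- //] _.
by apply: ltn_trans saj; apply: rl_maximaN_gt => //; apply: no_max; lia.
Qed.

Lemma dec_maxE d (i : 'I_d.+1) :
  dec_max d.+1 i = (if i < d then d.-1 - i else i) :> nat.
Proof. by rewrite permE /= ltnS; case: ifP; lia. Qed.

(* The window starting where an occurrence of the pattern starts contains a
   right-to-left maximum, which lies before the end of the occurrence: both are
   later and larger than the first entry, which allows only one such entry. *)
Lemma avoids_dec_max d : 0 < d ->
  meets_windows d (rl_maxima s) -> ~~ contains s (dec_max d.+1).
Proof.
move=> d_gt0 /meets_windowsP s_meets; apply/containsP => -[f f_mono f_patt].
have [e e_max /andP[fe ed]] := s_meets (f ord0).
have f_max := @ord_increasing_gap _ _ f ord0 ord_max f_mono isT.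
rewrite subn0 /= in f_max.
have s_max : s (f ord0) < s (f ord_max).
  by rewrite f_patt !dec_maxE /= ltnn d_gt0; lia.
have se := rl_maxima_gt e_max (leq_trans ed f_max).
case: (ltngtP (f ord0) e) fe => [fe|//|/val_inj fe] _.
  have f_lt : f ord0 < f ord_max by lia.
  have := noninversion_unique fe f_lt (ltn_trans s_max se) s_max.
  by move/(congr1 val) => /=; lia.
by rewrite fe in s_max; lia.
Qed.

Lemma contains_dec_max d : 0 < d ->
  ~~ meets_windows d (rl_maxima s) -> contains s (dec_max d.+1).
Proof.
move=> d_gt0; rewrite negb_forall => /existsP[a /exists_inPn no_max_in].
have no_max (i : 'I_n) : a <= i < a + d -> i \notin rl_maxima s.
  by apply: contraTN => /no_max_in.
have [j aj j_gt] := rl_maxima_free_window d_gt0 no_max.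
have lt_n (x : 'I_d.+1) : (if x < d then a + x else j) < n.
  by have := ltn_ord j; case: ifP; lia.
pose f x := Ordinal (lt_n x).
have f_window (x : 'I_d.+1) : x < d -> a <= f x < a + d.
  by move=> xd; rewrite /= xd; lia.
have f_last (x : 'I_d.+1) : d <= x -> f x = j.
  by move=> dx; apply: val_inj; rewrite /= ltnNge dx.
have f_mono (x y : 'I_d.+1) : x < y -> f x < f y.
  by move=> xy; have := ltn_ord y; rewrite /=; do 2!case: ifP; lia.
apply: (contains_intro f_mono) => x y xy; have := ltn_ord y; rewrite !dec_maxE.
have xd : x < d by have := ltn_ord y; lia.
rewrite xd; case: (ltnP y d) => [yd|dy] _.
  have := rl_maximaN_gt (f_mono _ _ xy); rewrite no_max ?f_window // => /(_ isT).
  by lia.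
by rewrite (f_last y) // j_gt ?f_window //; lia.
Qed.

End SparseNoninversions.

Lemma rl_maxima_inj n (s t : 'S_n) :
    sparse_noninversions s -> sparse_noninversions t ->
  rl_maxima s = rl_maxima t -> s = t.
Proof.
move=> s_sparse t_sparse eq_st; apply: card_noninversions_inj => i.
by rewrite !card_sparse_noninversions // eq_st.
Qed.

Lemma mem_avoiders n d (s : 'S_n) : 0 < d ->
  (s \in avoiders n [:: Pattern p123; Pattern p132; Pattern (dec_max d.+1)]) =
  sparse_noninversions s && meets_windows d (rl_maxima s).
Proof.
move=> d_gt0; rewrite inE /= andbT andbA avoids_p123_p132.
apply: andb_id2l => s_sparse; apply/idP/idP; last exact: avoids_dec_max.
by apply: contraNT; apply: contains_dec_max.
Qed.

Lemma imset_rl_maxima n d : 0 < d ->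
  @rl_maxima n @: avoiders n [:: Pattern p123; Pattern p132; Pattern (dec_max d.+1)]
    = [set E | meets_windows d E].
Proof.
move=> d_gt0; apply/setP => E; rewrite inE.
apply/imsetP/idP => [[s + ->]|E_meets]; first by rewrite mem_avoiders // => /andP[].
have [s s_sparse s_max] := rl_maxima_surj (meets_windows_cofinal E_meets).
by exists s; rewrite // mem_avoiders // s_sparse s_max.
Qed.

(** * Tilings *)

Lemma eq_partition (T : finType) (P Q : {set {set T}}) (D : {set T}) :
    partition P D -> partition Q D ->
    {in D &, forall x y, (pblock P x == pblock P y) = (pblock Q x == pblock Q y)} ->
  P = Q.
Proof.
move=> P_part Q_part eq_PQ.
rewrite -(preim_partition_pblock P_part) -(preim_partition_pblock Q_part).
apply: eq_in_imset => x Dx; apply/setP => y; rewrite !inE.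
by apply: andb_id2l => Dy; apply: eq_PQ.
Qed.

Definition interval n (B : {set 'I_n}) : Prop :=
  forall x y z : 'I_n, x \in B -> y \in B -> x <= z <= y -> z \in B.

Definition span_le n d (B : {set 'I_n}) : Prop :=
  forall x y : 'I_n, x \in B -> y \in B -> y < x + d.

Lemma tileP n d (B : {set 'I_n}) : B != set0 ->
  reflect (interval B /\ span_le d B)
          [exists l : 'I_d, is_tile l.+1 B].
Proof.
move/set0Pn => B_neq0.
apply: (iffP existsP) => [[l /existsP[i /andP[_ /eqP ->]]]|[B_int B_lt]].
  split=> [x y z|x y]; rewrite !inE; first by lia.
  by have := ltn_ord l; lia.
have [x0 Bx0] := B_neq0.
case: (arg_minnP (fun x : 'I_n => x : nat) Bx0) => i Bi i_min.
case: (arg_maxnP (fun x : 'I_n => x : nat) Bx0) => j Bj j_max.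
have ij := i_min j Bj; have lt_d : j - i < d by have := B_lt i j Bi Bj; lia.
exists (Ordinal lt_d); apply/existsP; exists i => /=; apply/andP; split.
  by have := ltn_ord j; lia.
apply/eqP/setP => x; rewrite inE; apply/idP/idP => [Bx|ix].
  by have := i_min x Bx; have := j_max x Bx; rewrite /=; lia.
by apply: B_int Bi Bj _; lia.
Qed.

Definition interval_partition n (T : {set {set 'I_n}}) : Prop :=
  partition T [set: 'I_n] /\ {in T, forall B, interval B}.

Lemma mem_tilingsP n d (T : {set {set 'I_n}}) :
  reflect (interval_partition T /\ {in T, forall B, span_le d B})
          (T \in tilings n d).
Proof.
rewrite inE; apply: (iffP andP) => [[T_part /forall_inP T_tile]|[[T_part T_int] T_lt]].
  have T_neq0 B : B \in T -> B != set0.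
    by apply: contraTneq => ->; case/and3P: T_part.
  by do 2?split=> //; move=> B TB; have /tileP[] := T_tile B TB; try exact: T_neq0.
split=> //; apply/forall_inP => B TB; apply/tileP.
  by apply: contraTneq TB => ->; case/and3P: T_part.
by split; [exact: T_int | exact: T_lt].
Qed.

Definition ends_before n (E : {set 'I_n}) (x : 'I_n) : {set 'I_n} :=
  [set e in E | e < x].

Definition blocks_ending_at n (E : {set 'I_n}) : {set {set 'I_n}} :=
  preim_partition (ends_before E) [set: 'I_n].

Definition block_ends n (T : {set {set 'I_n}}) : {set 'I_n} :=
  [set x : 'I_n | [forall y in pblock T x, y <= x]].

Lemma eq_ends_before n (E : {set 'I_n}) (x y : 'I_n) : x <= y ->
  (ends_before E x == ends_before E y) = ~~ [exists e in E, x <= e < y].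
Proof.
move=> xy; apply/eqP/exists_inPn => [/setP eq_xy e Ee|no_end].
  by have := eq_xy e; rewrite !inE Ee /=; lia.
by apply/setP => e; rewrite !inE; apply: andb_id2l => /no_end; lia.
Qed.

Lemma partition_blocks_ending_at n (E : {set 'I_n}) :
  partition (blocks_ending_at E) [set: 'I_n].
Proof. exact: preim_partitionP. Qed.

Lemma mem_pblock_blocks_ending_at n (E : {set 'I_n}) (x y : 'I_n) :
  (y \in pblock (blocks_ending_at E) x) = (ends_before E x == ends_before E y).
Proof.
by apply: pblock_equivalence_partition; rewrite ?inE //; split=> // /eqP->.
Qed.

Lemma interval_partition_blocks_ending_at n (E : {set 'I_n}) :
  interval_partition (blocks_ending_at E).
Proof.
split=> [|_ /imsetP[x0 _ ->] x y z]; first exact: partition_blocks_ending_at.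
rewrite !inE /= => /eqP -> /eqP eq_xy /andP[xz zy].
move/eqP: eq_xy; rewrite !eq_ends_before ?(leq_trans xz) //.
apply: contra => /exists_inP[e Ee /andP[xe ez]]; apply/exists_inP; exists e => //.
by rewrite xe (leq_trans ez).
Qed.

Lemma blocks_ending_at_tilings n d (E : {set 'I_n}) :
  meets_windows d E -> blocks_ending_at E \in tilings n d.
Proof.
move/meets_windowsP => E_meets; apply/mem_tilingsP.
split=> [|_ /imsetP[x0 _ ->] x y]; first exact: interval_partition_blocks_ending_at.
rewrite !inE /= => /eqP -> eq_xy; rewrite ltnNge; apply: contraL eq_xy => xy.
rewrite eq_ends_before ?negbK; last by lia.
by have [e Ee xe] := E_meets x; apply/exists_inP; exists e => //; lia.
Qed.

Lemma blocks_ending_atK n (E : {set 'I_n}) :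
  cofinal E -> block_ends (blocks_ending_at E) = E.
Proof.
move=> E_cofinal; apply/setP => x; rewrite inE.
apply/forall_inP/idP => [x_max|Ex y]; last first.
  rewrite mem_pblock_blocks_ending_at leqNgt; apply: contraL => xy.
  rewrite (eq_ends_before _ (ltnW xy)) negbK.
  by apply/exists_inP; exists x; rewrite ?leqnn.
have [e Ee] := E_cofinal x; case: (ltngtP x e) => [xe|//|/val_inj -> //] _.
have x1_lt_n : x.+1 < n by have := ltn_ord e; lia.
have : Ordinal x1_lt_n \notin pblock (blocks_ending_at E) x.
  by apply/negP => /x_max; rewrite /= ltnn.
rewrite mem_pblock_blocks_ending_at eq_ends_before // negbK => /exists_inP[i Ei /= xi].
by have <- : i = x by apply: val_inj => /=; lia.
Qed.

Section IntervalPartition.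

Variables (n : nat) (T : {set {set 'I_n}}).
Hypothesis T_int : interval_partition T.

Let T_triv : trivIset T.
Proof. by case: T_int => /and3P[]. Qed.

Let mem_cover x : x \in cover T.
Proof. by have [/cover_partition->] := T_int; rewrite inE. Qed.

Let mem_pblock_self x : x \in pblock T x.
Proof. by rewrite mem_pblock. Qed.

Lemma interval_pblock x : interval (pblock T x).
Proof. by have [_] := T_int; apply; apply: pblock_mem. Qed.

Lemma exists_block_end (x : 'I_n) :
  exists e : 'I_n, [/\ e \in block_ends T, e \in pblock T x & x <= e].
Proof.
case: (arg_maxnP (fun y : 'I_n => y : nat) (mem_pblock_self x)) => e ex e_max.
exists e; split=> //; last exact: (e_max x (mem_pblock_self x)).
by rewrite inE (same_pblock T_triv ex); apply/forall_inP.
Qed.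

Lemma eq_pblock_block_ends (x y : 'I_n) : x <= y ->
  (pblock T x == pblock T y) = ~~ [exists e in block_ends T, x <= e < y].
Proof.
move=> xy; rewrite eq_pblock //; apply/idP/exists_inPn => [yx e|no_end].
  rewrite inE => /forall_inP e_max; apply/negP => /andP[xe ey].
  have ex : e \in pblock T x.
    by apply: interval_pblock (mem_pblock_self x) yx _; rewrite xe (ltnW ey).
  by have := e_max y; rewrite (same_pblock T_triv ex) yx => /(_ isT); lia.
have [e [e_end ex xe]] := exists_block_end x; have := no_end e e_end.
rewrite xe -leqNgt => ye.
by apply: interval_pblock (mem_pblock_self x) ex _; rewrite xy.
Qed.

Lemma block_endsK : blocks_ending_at (block_ends T) = T.
Proof.
have [T_part _] := T_int; apply: eq_partition T_part _ => [|x y _ _].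
  exact: partition_blocks_ending_at.
wlog xy : x y / x <= y.
  by move=> wl; case/orP: (leq_total x y) => /wl //; rewrite ![_ == pblock _ x]eq_sym.
rewrite eq_pblock_block_ends // -eq_ends_before // -mem_pblock_blocks_ending_at.
have [/eqP E_cover E_triv _] := and3P (partition_blocks_ending_at (block_ends T)).
by rewrite eq_pblock // E_cover inE.
Qed.

Lemma meets_windows_block_ends d :
  {in T, forall B, span_le d B} -> meets_windows d (block_ends T).
Proof.
move=> T_span; apply/meets_windowsP => x.
have [e [e_end ex xe]] := exists_block_end x; exists e; rewrite // xe /=.
by apply: T_span (mem_pblock_self x) ex; apply: pblock_mem.
Qed.

End IntervalPartition.

Lemma imset_blocks_ending_at n d :
  @blocks_ending_at n @: [set E | meets_windows d E] = tilings n d.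
Proof.
apply/setP => T; apply/imsetP/idP => [[E + ->]|/mem_tilingsP[T_int T_span]].
  by rewrite inE; apply: blocks_ending_at_tilings.
exists (block_ends T); first by rewrite inE meets_windows_block_ends.
by rewrite block_endsK.
Qed.

Theorem theorem3p13 (n k : nat) (hn : 1 <= n) (hk : 2 <= k) :
  exists f : {s : 'S_n | s \in avoiders n [:: Pattern p123; Pattern p132; Pattern (dec_max k)]} ->
             {T : {set {set 'I_n}} | T \in tilings n (k - 1)},
    bijective f.
Proof.
case: k hk => // d d_gt0; rewrite subn1 /=.
apply: (@imset_sig_bij _ _ _ _ (@blocks_ending_at n \o @rl_maxima n)); last first.
  by rewrite imset_comp imset_rl_maxima // imset_blocks_ending_at.
move=> s t; rewrite !mem_avoiders // => /andP[s_sparse s_meets].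
case/andP=> t_sparse t_meets /(congr1 (@block_ends n)) /=.
rewrite (blocks_ending_atK (meets_windows_cofinal s_meets)).
rewrite (blocks_ending_atK (meets_windows_cofinal t_meets)).
exact: rl_maxima_inj.
Qed.
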